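(* Let $\mathcal{X},\mathcal{Y}$ be finite sets, $\sim$ a symmetric binary relation on $\mathcal{X}$, $\{C_i\}_{i\in\mathcal{I}}$ a finite family of compatible channels $C_i:\mathcal{X}\times\mathcal{Y}\to\mathbb{R}$, each conforming to $\sim$, and let $\mu$ be a probability distribution on $\mathcal{I}$. Then: (1) $\mathbb{V}^{\rm DP}$ is quasi-convex with respect to hidden choice: $$\mathbb{V}^{\rm DP}\Bigl[\sum_{i\in\mathcal{I}}\mu(i)C_i\Bigr]\le\max_{i\in\mathrm{supp}(\mu)}\mathbb{V}^{\rm DP}[C_i].$$ (2) $\mathbb{V}^{\rm DP}$ is quasi-max with respect to visible choice: $$\mathbb{V}^{\rm DP}\Bigl[\bigsqcup_{i\leftarrow\mu}C_i\Bigr]=\max_{i\in\mathrm{supp}(\mu)}\mathbb{V}^{\rm DP}[C_i].$$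
   Context: A channel $C:\mathcal{X}\times\mathcal{Y}\to\mathbb{R}$ satisfies $0\le C(x,y)\le1$ and $\sum_yC(x,y)=1$ for every $x$. Channels are compatible if they have the same row and column index sets. $\mathrm{supp}(\mu)=\{i:\mu(i)>0\}$. A channel $C$ is conforming to $\sim$ if for all $x\sim x'$ and all $y$: $C(x,y)=0$ iff $C(x',y)=0$. For such a channel, its differential-privacy level is $$\mathbb{V}^{\rm DP}[C]=\max_{\substack{y,x,x':\ x\sim x',\\ C(x,y)>0}}\ln\frac{C(x,y)}{C(x',y)}$$ (with the convention that the maximum is $0$ if $\sim$ is empty). Hidden choice: $\sum_i\mu(i)C_i$ is the entrywise convex combination, a channel $\mathcal{X}\times\mathcal{Y}\to\mathbb{R}$. Visible choice: $\bigsqcup_{i\leftarrow\mu}C_i$ is the channel from $\mathcal{X}$ to the disjoint union $\{(y,i): y\in\mathcal{Y},i\in\mathcal{I}\}$ given by $(x,(y,i))\mapsto\mu(i)\,C_i(x,y)$. *)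

(* Defs.v *)
From HB Require Import structures.
From mathcomp Require Import all_boot all_order all_algebra.
From mathcomp Require Import reals exp.

Set Implicit Arguments.
Unset Strict Implicit.
Unset Printing Implicit Defensive.

Import Order.TTheory GRing.Theory Num.Theory.
Local Open Scope ring_scope.

Record channel (R : realType) (X Y : finType) := Channel {
  channel_fun :> X -> Y -> R;
  channel_ge0 : forall x y, 0 <= channel_fun x y;
  channel_le1 : forall x y, channel_fun x y <= 1;
  channel_sum1 : forall x, \sum_y channel_fun x y = 1 }.

Record distr (R : realType) (I : finType) := Distr {
  distr_fun :> I -> R;
  distr_ge0 : forall i, 0 <= distr_fun i;
  distr_sum1 : \sum_i distr_fun i = 1 }.

Definition supp (R : realType) (I : finType) (mu : distr R I) : {set I} :=
  [set i | 0 < mu i].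

(* The neutral element is itself one of the values, so negative values are not
   clipped at 0; the value 0 for an empty index set is a convention. *)
Definition fmax (R : realType) (T : finType) (P : pred T) (F : T -> R) : R :=
  let s := [seq F t | t in P] in \big[Num.max/head 0 s]_(v <- s) v.

Definition conforming (R : realType) (X Y : finType) (adj : rel X)
    (C : X -> Y -> R) : Prop :=
  forall x x' y, adj x x' -> (C x y = 0 <-> C x' y = 0).

(* The triple t is ((x, x'), y).  If adj is nonempty, then so is the set of
   triples, because the rows of a channel sum to 1.  Meaningful only when C
   conforms to adj: then the denominator C x' y is positive on the index set;
   otherwise the total division makes ln (C x y / 0) equal to ln 0. *)
Definition VDP (R : realType) (X Y : finType) (adj : rel X)
    (C : channel R X Y) : R :=
  fmax [pred t : X * X * Y | adj t.1.1 t.1.2 && (0 < C t.1.1 t.2)]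
       (fun t => ln (C t.1.1 t.2 / C t.1.2 t.2)).

Section Choices.
Variables (R : realType) (X Y I : finType).
Variables (mu : distr R I) (C : I -> channel R X Y).

Definition hidden_fun (x : X) (y : Y) : R := \sum_i mu i * C i x y.

Definition visible_fun (x : X) (yi : Y * I) : R := mu yi.2 * C yi.2 x yi.1.

Lemma hidden_ge0 x y : 0 <= hidden_fun x y.
Proof.
by apply: sumr_ge0 => i _; rewrite mulr_ge0 ?distr_ge0 ?channel_ge0.
Qed.

Lemma hidden_le1 x y : hidden_fun x y <= 1.
Proof.
rewrite -(distr_sum1 mu); apply: ler_sum => i _.
by rewrite ler_piMr ?distr_ge0 ?channel_le1.
Qed.

Lemma hidden_sum1 x : \sum_y hidden_fun x y = 1.
Proof.
rewrite exchange_big -[RHS](distr_sum1 mu) /=; apply: eq_bigr => i _.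
by rewrite -mulr_sumr channel_sum1 mulr1.
Qed.

Lemma distr_le1 i : mu i <= 1.
Proof.
rewrite -(distr_sum1 mu) (bigD1 i) //= lerDl.
by apply: sumr_ge0 => j _; apply: distr_ge0.
Qed.

Lemma visible_ge0 x yi : 0 <= visible_fun x yi.
Proof. by rewrite mulr_ge0 ?distr_ge0 ?channel_ge0. Qed.

Lemma visible_le1 x yi : visible_fun x yi <= 1.
Proof.
by rewrite mulr_ile1 ?distr_ge0 ?channel_ge0 ?distr_le1 ?channel_le1.
Qed.

Lemma visible_sum1 x : \sum_yi visible_fun x yi = 1.
Proof.
rewrite -(hidden_sum1 x) /hidden_fun.
by rewrite (pair_bigA _ (fun y i => mu i * C i x y)).
Qed.

Definition hidden_choice : channel R X Y :=
  Channel hidden_ge0 hidden_le1 hidden_sum1.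

Definition visible_choice : channel R X (Y * I)%type :=
  Channel visible_ge0 visible_le1 visible_sum1.

Lemma conforming_hidden (adj : rel X) :
  (forall i, conforming adj (C i)) -> conforming adj hidden_choice.
Proof.
move=> Cc x x' y xx' /=.
have H z : hidden_fun z y = 0 <-> forall i, mu i * C i z y = 0.
  split=> [/eqP|H]; last by rewrite /hidden_fun big1.
  rewrite psumr_eq0 => [/allP H i|i _]; last first.
    by rewrite mulr_ge0 ?distr_ge0 ?channel_ge0.
  by apply/eqP/H; rewrite mem_index_enum.
rewrite !H; split=> E i; move/eqP: (E i); rewrite mulf_eq0;
  case/orP=> /eqP Ei; rewrite ?Ei ?mul0r //.
  by rewrite (Cc i x x' y xx').1 ?mulr0.
by rewrite (Cc i x x' y xx').2 ?mulr0.
Qed.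

Lemma conforming_visible (adj : rel X) :
  (forall i, conforming adj (C i)) -> conforming adj visible_choice.
Proof.
move=> Cc x x' [y i] xx'; rewrite /= /visible_fun /=.
split=> /eqP; rewrite mulf_eq0; case/orP=> /eqP E; rewrite ?E ?mul0r //.
  by rewrite (Cc i x x' y xx').1 ?mulr0.
by rewrite (Cc i x x' y xx').2 ?mulr0.
Qed.

End Choices.

Section FmaxTheory.
Variables (R : realType) (T : finType) (P : pred T) (F : T -> R).

Lemma fmax_ge t : P t -> F t <= fmax P F.
Proof.
move=> Pt; rewrite /fmax /=; set s := image _ _.
have : F t \in s by apply: image_f.
by move=> Fs; apply: le_bigmax_seq Fs _.
Qed.

Lemma fmax_attained t0 : P t0 -> exists2 t, P t & fmax P F = F t.
Proof.
move=> Pt0; rewrite /fmax /=; set s := image _ _.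
have s_mem : \big[Num.max/head 0 s]_(v <- s) v \in s.
  have hs : head 0 s \in s.
    have : F t0 \in s by apply: image_f.
    by case: s => //= a s' _; rewrite mem_head.
  rewrite big_seq; elim/big_ind: _ => // a b ain bin.
  by rewrite /Num.max; case: ifP.
by case/imageP: s_mem => t Pt ->; exists t.
Qed.

Lemma fmax_empty : P =1 pred0 -> fmax P F = 0.
Proof.
by move=> P0; rewrite /fmax /image_mem (eq_enum P0) enum0 /= big_nil.
Qed.

End FmaxTheory.

(* Main.v *)
(** For conforming [C] and inhabited [adj], [VDP adj C <= m] holds iff
    [C x y <= expR m * C x' y] whenever [adj x x'].  This linear condition
    passes to convex combinations and, for visible choice, holds iff it holds
    for each [C i] with [0 < mu i], as the positive factor [mu i] cancels. *)
Require Import Defs.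
From HB Require Import structures.
From mathcomp Require Import all_boot all_order all_algebra.
From mathcomp Require Import reals exp.
From mathcomp Require Import sequences.

Import Order.TTheory GRing.Theory Num.Theory.
Local Open Scope ring_scope.

(** Otherwise the sum would be at most 0. This makes the index sets of the maxima nonempty. *)
Lemma sum1_gt0 {R : realType} {T : finType} {f : T -> R} :
  \sum_t f t = 1 -> exists t, 0 < f t.
Proof.
move=> f1; apply/existsP; apply: contraPT (@ltr01 R) => /existsPn f_le0.
rewrite -f1 => /lt_geF/negP; apply.
by apply: sumr_le0 => t _; rewrite leNgt.
Qed.

(** Inhabitation of [P] excludes the conventional value 0, which would break the equivalence for
    negative [m]. *)
Lemma fmax_leP {R : realType} {T : finType} {P : pred T} {F : T -> R} {m : R} :
  (exists t, P t) -> (fmax P F <= m <-> forall t, P t -> F t <= m).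
Proof.
move=> [t0 Pt0]; split=> [Fm t Pt|Fm]; first exact: le_trans (fmax_ge F Pt) Fm.
by have [t Pt ->] := fmax_attained F Pt0; apply: Fm.
Qed.

Lemma VDP_leP {R : realType} {X Y : finType} {adj : rel X}
    {C : channel R X Y} {m : R} :
  conforming adj C -> (exists x x', adj x x') ->
  (VDP adj C <= m <->
   forall x x' y, adj x x' -> C x y <= expR m * C x' y).
Proof.
move=> Cc [x0 [x0' adj0]].
have [y0 Cy0] := sum1_gt0 (channel_sum1 C x0).
have ln_ratio x x' y : adj x x' -> 0 < C x y ->
    (ln (C x y / C x' y) <= m) = (C x y <= expR m * C x' y).
  move=> adjx Cxy.
  have Cx'y : 0 < C x' y.
    rewrite lt_def channel_ge0 andbT; apply/eqP => /(Cc _ _ _ adjx).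
    by move/eqP; rewrite gt_eqF.
  by rewrite -ler_pdivrMr // -ler_expR lnK // posrE divr_gt0.
rewrite /VDP fmax_leP; last by exists (x0, x0', y0); rewrite /= adj0.
split=> [Cm x x' y adjx|Cm [[x x'] y] /andP[/= adjx Cxy]]; last first.
  by rewrite ln_ratio ?Cm.
(* Triples with [C x y = 0] are not indexed by the maximum, but there the linear bound is
   trivial. *)
have [Cxy|Cxy] := ltP 0 (C x y).
  by rewrite -ln_ratio //; apply: (Cm (x, x', y)); rewrite /= adjx.
by rewrite (le_trans Cxy) // mulr_ge0 ?expR_ge0 ?channel_ge0.
Qed.

Lemma VDP_empty {R : realType} {X Y : finType} {adj : rel X}
    (C : channel R X Y) :
  (forall x x', ~~ adj x x') -> VDP adj C = 0.
Proof. by move=> adj0; apply: fmax_empty => t /=; rewrite (negPf (adj0 _ _)). Qed.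

Theorem theorem14 (R : realType) (X Y I : finType) (adj : rel X)
    (C : I -> channel R X Y) (mu : distr R I)
    (adj_sym : symmetric adj)
    (C_conf : forall i : I, conforming adj (C i)) :
  VDP adj (hidden_choice mu C)
    <= fmax [pred i | i \in supp mu] (fun i => VDP adj (C i))
  /\
  VDP adj (visible_choice mu C)
    = fmax [pred i | i \in supp mu] (fun i => VDP adj (C i)).
Proof.
have supp_mu : exists i, [pred i | i \in supp mu] i.
  by have [i mui] := sum1_gt0 (distr_sum1 mu); exists i; rewrite /= inE.
set m := fmax _ _.
have [/existsP[x0 /existsP[x0' adj0]]|/existsPn adj0] :=
    boolP [exists x, exists x', adj x x']; last first.
  (* With [adj] empty every level is 0, and so is [m], being attained at some [i]. *)
  have {}adj0 x x' : ~~ adj x x' by move/existsPn: (adj0 x); apply.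
  have [i0 suppi0] := supp_mu.
  have [i _ m_eq] := fmax_attained (fun i => VDP adj (C i)) suppi0.
  by rewrite /m m_eq !VDP_empty.
have adj_ex : exists x x', adj x x' by exists x0, x0'.
(* Keeping the weight [mu i] makes the bound hold for every [i]: off the support, where [m] does not
   control [C i], both sides vanish. *)
have term_le i x x' y : adj x x' ->
    mu i * C i x y <= expR m * (mu i * C i x' y).
  move=> adjx; rewrite mulrCA.
  have := distr_ge0 mu i; rewrite le_eqVlt => /predU1P[<-|mui].
    by rewrite !mul0r.
  rewrite ler_pM2l //; apply: (VDP_leP (C_conf i) adj_ex).1 adjx.
  by apply: (fmax_ge (fun i => VDP adj (C i))); rewrite /= inE.
split.
  have hidden_conf := conforming_hidden mu C_conf.
  apply/(VDP_leP hidden_conf adj_ex) => x x' y adjx.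
  by rewrite /= /hidden_fun mulr_sumr; apply: ler_sum => i _; apply: term_le.
have visible_conf := conforming_visible mu C_conf.
apply/eqP; rewrite eq_le; apply/andP; split.
  by apply/(VDP_leP visible_conf adj_ex) => x x' [y i] /term_le; apply.
apply/fmax_leP => // i; rewrite /= inE => mui.
apply/(VDP_leP (C_conf i) adj_ex) => x x' y adjx.
(* Scaled by [mu i], the goal is the bound for the visible choice at column [(y, i)], with its own
   level as constant. *)
rewrite -(ler_pM2l mui) mulrCA.
exact: (VDP_leP visible_conf adj_ex).1 (lexx _) x x' (y, i) adjx.
Qed.
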